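(* Let $G$ be a finite abelian group and $H$ a subgroup of $G$. Then the subgroup sum graph $\Gamma_{G,H}$ and the extended subgroup sum graph $\Gamma^+_{G,H}$ are perfect graphs.
   Context: Groups are written additively with identity $0$. For a finite abelian group $G$ and a subgroup $H$, the extended subgroup sum graph $\Gamma^+_{G,H}$ is the simple graph with vertex set $G$ in which distinct $x,y$ are adjacent iff $x+y\in H$; the subgroup sum graph $\Gamma_{G,H}$ is the simple graph with vertex set $G$ in which distinct $x,y$ are adjacent iff $x+y\in H\setminus\{0\}$. A graph is perfect if every induced subgraph has clique number equal to its chromatic number. *)

(* Defs.v *)
From HB Require Import structures.
From mathcomp Require Import all_boot all_order all_algebra.

Set Implicit Arguments.
Unset Strict Implicit.
Unset Printing Implicit Defensive.

Import GRing.Theory.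
Local Open Scope ring_scope.

Record sgraph := SGraph {
  svertex :> finType;
  sedge : rel svertex;
  sedge_sym : symmetric sedge;
  sedge_irr : irreflexive sedge }.

Section Graphs.

Variable X : sgraph.

Definition clique (K : {set X}) : bool :=
  [forall x in K, forall y in K, (x != y) ==> sedge x y].

Definition clique_number : nat :=
  (\max_(K : {set X} | clique K) #|K|)%N.

Definition colorable (k : nat) : bool :=
  [exists c : {ffun X -> 'I_k}, forall x, forall y, sedge x y ==> (c x != c y)].

Lemma colorable_ex : exists k, colorable k.
Proof.
exists #|X|; apply/existsP; exists [ffun x => enum_rank x].
apply/forallP=> x; apply/forallP=> y; apply/implyP=> xy.
rewrite !ffunE (inj_eq enum_rank_inj).
by apply: contraTneq xy => ->; rewrite sedge_irr.
Qed.

Definition chromatic_number : nat := ex_minn colorable_ex.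

Section Induced.

Variable S : {set X}.

Definition induced_edge : rel {x : X | x \in S} :=
  fun u v => sedge (val u) (val v).

Lemma induced_sym : symmetric induced_edge.
Proof. by move=> u v; apply: sedge_sym. Qed.

Lemma induced_irr : irreflexive induced_edge.
Proof. by move=> u; apply: sedge_irr. Qed.

(* The vertex type is the subtype of S, so that the subgraph induced by the
   empty set has chromatic number 0, as its clique number. *)
Definition induced : sgraph := SGraph induced_sym induced_irr.

End Induced.

End Graphs.

Definition perfect (X : sgraph) : Prop :=
  forall S : {set X},
    clique_number (induced S) = chromatic_number (induced S).

Section SumGraphs.

Variables (G : finZmodType) (H : {set G}).

Definition ext_sum_edge : rel G :=
  fun x y => (x != y) && (x + y \in H).

Lemma ext_sum_edge_sym : symmetric ext_sum_edge.
Proof. by move=> x y; rewrite /ext_sum_edge eq_sym addrC. Qed.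

Lemma ext_sum_edge_irr : irreflexive ext_sum_edge.
Proof. by move=> x; rewrite /ext_sum_edge eqxx. Qed.

Definition ext_subgroup_sum_graph : sgraph :=
  SGraph ext_sum_edge_sym ext_sum_edge_irr.

Definition sum_edge : rel G :=
  fun x y => (x != y) && (x + y \in H :\ 0).

Lemma sum_edge_sym : symmetric sum_edge.
Proof. by move=> x y; rewrite /sum_edge eq_sym addrC. Qed.

Lemma sum_edge_irr : irreflexive sum_edge.
Proof. by move=> x; rewrite /sum_edge eqxx. Qed.

Definition subgroup_sum_graph : sgraph :=
  SGraph sum_edge_sym sum_edge_irr.

End SumGraphs.

(* Main.v *)
Require Import Defs.
From mathcomp Require Import all_boot all_order all_algebra.

(** The relation [x + y \in H] links the coset [x + H] to the coset [- x + H]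
    only.  The vertices [x] with [x + x \in H] are those whose coset is its own
    opposite: on them, each coset induces a complete multipartite graph, with
    parts [{x}] in the extended graph and [{x, - x}] in the other one.  On the
    remaining vertices the graph is bipartite, since the cosets [x + H] and
    [- x + H] are distinct.  There is no edge between the two kinds of vertices.

    Perfection is derived from a local criterion ([perfect_of_tight]): it is
    enough to colour every vertex set [S] by natural numbers so that each vertex
    [x] of [S] has a colour smaller than the size of some clique of [S].  This
    criterion does not require a maximum clique to be exhibited, and such
    colourings on sets with no edge in between can be glued ([tight_glue]).
    They exist on bipartite sets ([tight_bipartite]) and on disjoint unions of
    complete multipartite graphs ([tight_multipartite]). *)

Set Implicit Arguments.
Unset Strict Implicit.
Unset Printing Implicit Defensive.

Import GRing.Theory.

(** * Cliques and colourings *)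

Section Graph.

Variable X : sgraph.
Implicit Type K : {set X}.

Lemma cliqueP K :
  reflect {in K &, forall x y, x != y -> sedge x y} (clique K).
Proof.
apply: (iffP forall_inP) => [cK x y xK yK | cK x xK].
  by move/implyP: (forall_inP (cK x xK) y yK).
by apply/forall_inP => y yK; apply/implyP; apply: cK.
Qed.

Lemma colorableP k :
  reflect (exists c : X -> 'I_k, forall x y, sedge x y -> c x != c y)
          (colorable X k).
Proof.
apply: (iffP existsP) => [[c cP] | [c cP]].
  by exists c => x y; apply/implyP; move/forallP/(_ x)/forallP: cP.
exists (finfun c); apply/forallP => x; apply/forallP => y.
by rewrite !ffunE; apply/implyP; apply: cP.
Qed.

Lemma leq_clique_number K : clique K -> #|K| <= clique_number X.
Proof. by rewrite /clique_number => cK; apply: leq_bigmax_cond. Qed.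

Lemma leq_chromatic_number k : colorable X k -> chromatic_number X <= k.
Proof. by rewrite /chromatic_number; case: ex_minnP => m _; apply. Qed.

Lemma clique_number_le_chromatic : clique_number X <= chromatic_number X.
Proof.
rewrite /chromatic_number; case: ex_minnP => k /colorableP[c cP] _.
apply/bigmax_leqP => K /cliqueP cK.
rewrite -[k]card_ord -(@card_in_imset _ _ c) ?max_card // => x y xK yK cxy.
by apply: contra_eq cxy => xy; apply/cP/cK.
Qed.

End Graph.

(** * Tight colourings *)

Section Tight.

Variable X : sgraph.
Implicit Types (S K T : {set X}) (c : X -> nat).

(** A proper colouring [c] of the subgraph induced by [S], by natural numbers
    counted from 0, in which the number of colours up to [c x] is at most the
    size of some clique of [S], for every [x] in [S]. *)
Definition tight_coloring S c : Prop :=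
  {in S &, forall x y, sedge x y -> c x != c y} /\
  {in S, forall x, exists K, [/\ K \subset S, clique K & c x < #|K|]}.

Lemma perfect_of_tight :
  (forall S, exists c, tight_coloring S c) -> perfect X.
Proof.
move=> tight S; have [c [c_proper c_tight]] := tight S.
apply/eqP; rewrite eqn_leq clique_number_le_chromatic /=.
apply: leq_chromatic_number.
have c_lt (u : induced S) : c (val u) < clique_number (induced S).
  have [K [/subsetP sKS /cliqueP cK ltcK]] := c_tight _ (valP u).
  pose L : {set induced S} := val @^-1: K.
  have cardL : #|K| = #|L|.
    rewrite -(card_imset _ val_inj); apply: eq_card => x.
    apply/idP/imsetP => [xK | [v]]; last by rewrite inE => ? ->.
    by exists (Sub x (sKS x xK) : induced S); rewrite ?inE ?SubK.
  rewrite cardL in ltcK.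
  apply: leq_trans ltcK _; apply: leq_clique_number.
  apply/cliqueP => v w; rewrite !inE => vK wK vw.
  by apply: (cK _ _ vK wK); rewrite (inj_eq val_inj).
apply/colorableP; exists (fun u => Ordinal (c_lt u)) => u v uv.
exact: c_proper (valP u) (valP v) uv.
Qed.

(** If no edge joins [T] to its complement, then tight colourings of the two
    parts of [S] cut out by [T] form together a tight colouring of [S]. *)
Lemma tight_glue S T c1 c2 :
    (forall x y, sedge x y -> (x \in T) = (y \in T)) ->
    tight_coloring (S :&: T) c1 -> tight_coloring (S :\: T) c2 ->
  tight_coloring S (fun x => if x \in T then c1 x else c2 x).
Proof.
move=> closedT [proper1 tight1] [proper2 tight2]; split=> [x y xS yS xy | x xS].
  rewrite -(closedT x y xy); case: ifPn => xT.
    by apply: proper1; rewrite ?inE ?xS ?yS -?(closedT x y xy).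
  by apply: proper2; rewrite ?inE ?xS ?yS -?(closedT x y xy) ?xT.
case: ifPn => xT.
  have [|K [sKS cK ltK]] := tight1 x; first by rewrite inE xS.
  by exists K; split=> //; apply: subset_trans sKS (subsetIl _ _).
have [|K [sKS cK ltK]] := tight2 x; first by rewrite inE xS xT.
by exists K; split=> //; apply: subset_trans sKS (subsetDl _ _).
Qed.

(** Isolated vertices and one side of the bipartition have colour 0; a vertex of
    colour 1 forms a clique with any of its neighbours. *)
Lemma tight_bipartite S (side : pred X) :
    {in S &, forall x y, sedge x y -> side x != side y} ->
  exists c, tight_coloring S c.
Proof.
move=> sideP; pose nbr x := [exists y in S, sedge x y].
exists (fun x => (side x && nbr x) : nat); split=> [x y xS yS xy | x xS].
  have -> : nbr x by apply/exists_inP; exists y.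
  have -> : nbr y by apply/exists_inP; exists x; rewrite // sedge_sym.
  by move: (sideP x y xS yS xy); rewrite !andbT; do 2!case: (side _).
case: andP => [[_ /exists_inP[y yS xy]] | _].
  exists [set x; y]; split; first by rewrite subUset !sub1set xS.
    apply/cliqueP => u v /set2P[]-> /set2P[]->; rewrite ?eqxx // => _ //.
    by rewrite sedge_sym.
  by rewrite cards2; case: eqP xy => // ->; rewrite sedge_irr.
exists [set x]; rewrite sub1set xS cards1; split=> //.
by apply/cliqueP => u v /set1P-> /set1P->; rewrite eqxx.
Qed.

(** If the subgraph induced by [S] is a disjoint union of complete multipartite
    graphs, with components the classes of [comp] and parts the classes of
    [part], then the vertex [x] receives as colour the number of parts that
    precede its own in its component, for a fixed order on parts.  Choosing one
    vertex in each of these parts and in the part of [x] gives the clique. *)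
Lemma tight_multipartite S (C : eqType) (P : finType)
    (comp : X -> C) (part : X -> P) :
    {in S &, forall x y,
      sedge x y = (comp x == comp y) && (part x != part y)} ->
  exists c, tight_coloring S c.
Proof.
move=> edgeE; pose rk x := enum_rank (part x).
pose below x := part @: [set z in S | (comp z == comp x) && (rk z < rk x)].
pose upto x := part @: [set z in S | (comp z == comp x) && (rk z <= rk x)].
have below_lt x : x \in S -> #|below x| < #|upto x|.
  move=> xS; apply/proper_card/properP; split.
    by apply/imsetS/subsetP => z; rewrite !inE => /and3P[-> -> /ltnW->].
  exists (part x); first by apply: imset_f; rewrite !inE xS eqxx leqnn.
  apply/imsetP => -[z]; rewrite !inE => /and3P[_ _ ltzx] eq_part.
  by rewrite /rk eq_part ltnn in ltzx.
exists (fun x => #|below x|); split=> [x y xS yS | x xS].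
  rewrite (edgeE x y xS yS) => /andP[/eqP eq_comp neq_part].
  wlog ltxy : x y xS yS eq_comp neq_part / rk x < rk y.
    move=> ltP; case: (ltngtP (rk x) (rk y)) => [ltxy | ltyx | /val_inj eqxy].
    - exact: ltP.
    - by rewrite eq_sym; apply: ltP; rewrite // eq_sym.
    - by rewrite (enum_rank_inj eqxy) eqxx in neq_part.
  rewrite neq_ltn (leq_trans (below_lt x xS)) //.
  apply/subset_leq_card/imsetS/subsetP => z; rewrite !inE eq_comp.
  by case/and3P=> -> -> /leq_ltn_trans->.
pose A := [set z in S | (comp z == comp x) && (rk z <= rk x)].
pose repr i := odflt x [pick z in A | part z == i].
have reprP i : i \in upto x -> repr i \in A /\ part (repr i) = i.
  case/imsetP=> z zA ->; rewrite /repr.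
  by case: pickP => [w /andP[wA /eqP] | /(_ z)] //=; rewrite zA eqxx.
exists (repr @: upto x); split.
- apply/subsetP => _ /imsetP[i /reprP[iA _] ->].
  by move: iA; rewrite inE => /andP[].
- apply/cliqueP => u v /imsetP[i /reprP[iA parti] ->{u}].
  case/imsetP=> j /reprP[jA partj] ->{v} neq_ij.
  move: iA jA; rewrite !inE => /and3P[iS /eqP compi _] /and3P[jS /eqP compj _].
  rewrite edgeE // compi compj eqxx parti partj.
  by apply: contraNneq neq_ij => ->.
rewrite card_in_imset; first exact: below_lt.
by move=> i j /reprP[_ parti] /reprP[_ partj] eq_ij; rewrite -parti eq_ij.
Qed.

End Tight.

(** * Sum graphs *)

Section SumGraph.

Local Open Scope ring_scope.

Variables (G : finZmodType) (H : {set G}).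
Hypothesis subgH : GRing.zmod_closed H.

Let mem0H : 0 \in H. Proof. by case: subgH. Qed.

Let memB x y : x \in H -> y \in H -> x - y \in H.
Proof. by case: subgH => _; apply. Qed.

Let memN x : (- x \in H) = (x \in H).
Proof.
suff memNw z : z \in H -> - z \in H.
  by apply/idP/idP => /memNw; rewrite ?opprK.
by rewrite -[- z]sub0r; apply: memB.
Qed.

Let memD x y : x \in H -> y \in H -> x + y \in H.
Proof. by move=> xH yH; rewrite -[y]opprK memB ?memN. Qed.

(** The coset [x + H]. *)
Definition subg_coset x : {set G} := [set z | z - x \in H].

Lemma subg_coset_eq x y : (subg_coset x == subg_coset y) = (x - y \in H).
Proof.
apply/eqP/idP => [/setP/(_ x) | xyH].
  by rewrite !inE subrr mem0H => <-.
apply/setP => z; rewrite !inE; apply/idP/idP => zH.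
  by rewrite -(subrKA x) memD.
by rewrite -(subrKA y) memD // -opprB memN.
Qed.

(** The two sum graphs are treated together: they are given by [x + y \in H]
    for [x] and [y] in distinct parts, for suitable partitions of [G]. *)
Lemma perfect_sum_graph (P : finType) (part : G -> P) (e : rel G)
    (e_sym : symmetric e) (e_irr : irreflexive e) :
    (forall x y, e x y = (part x != part y) && (x + y \in H)) ->
  perfect (SGraph e_sym e_irr).
Proof.
move=> eE; set X := SGraph e_sym e_irr.
apply: perfect_of_tight => S; pose T : {set X} := [set x : G | x + x \in H].
have closedT (x y : X) : sedge x y -> (x \in T) = (y \in T).
  rewrite [sedge x y]eE => /andP[_ xyH]; rewrite !inE.
  have sumE : (x + x) + (y + y) = (x + y) + (x + y) by rewrite addrACA.
  apply/idP/idP => ?.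
    by rewrite -[y + y](addKr (x + x)) sumE addrC memB // memD.
  by rewrite -[x + x](addrK (y + y)) sumE memB // memD.
have [c1 tight1] : exists c, tight_coloring (S :&: T) c.
  apply: (@tight_multipartite X _ _ P subg_coset part) => x y.
  rewrite !inE => /andP[_ xT] /andP[_ yT].
  rewrite [LHS]eE andbC subg_coset_eq; congr (_ && _).
  have xyE : x - y = (x + y) - (y + y) by rewrite opprD addrA addrK.
  apply/idP/idP => xyH; first by rewrite xyE memB.
  by rewrite -[x + y](subrK (y + y)) -xyE memD.
have [c2 tight2] : exists c, tight_coloring (S :\: T) c.
  (* [x + H] and [- x + H] are distinct here, hence comparable for the order
     of enumeration of the subsets of [G]; adding up to an element of [H]
     exchanges them *)
  pose side x := (enum_rank (subg_coset x) < enum_rank (subg_coset (- x)))%N.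
  apply: (@tight_bipartite X _ side) => x y; rewrite !inE => /andP[xT _] _.
  rewrite [sedge x y]eE => /andP[_ xyH]; rewrite /side.
  have -> : subg_coset y = subg_coset (- x).
    by apply/eqP; rewrite subg_coset_eq opprK addrC.
  have -> : subg_coset (- y) = subg_coset x.
    by apply/eqP; rewrite subg_coset_eq -opprD memN addrC.
  have := xT; rewrite -{2}[x]opprK -subg_coset_eq.
  by rewrite -(inj_eq enum_rank_inj) -val_eqE /=; case: ltngtP.
by exists (fun x => if x \in T then c1 x else c2 x); apply: tight_glue.
Qed.

Lemma eq_set2N (x y : G) :
  ([set x; - x] == [set y; - y]) = (x == y) || (x + y == 0).
Proof.
rewrite addr_eq0; apply/eqP/orP => [/setP/(_ x) | [/eqP-> // | /eqP->]].
  by rewrite !inE eqxx => /esym/orP.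
by rewrite opprK setUC.
Qed.

End SumGraph.

Theorem corollary4p4 (G : finZmodType) (H : {set G}) (subgH : GRing.zmod_closed H) :
  perfect (subgroup_sum_graph H) /\ perfect (ext_subgroup_sum_graph H).
Proof.
split.
  apply: (perfect_sum_graph subgH (part := fun x => [set x; - x]%R)) => x y.
  by rewrite eq_set2N negb_or -andbA /sum_edge !inE.
exact: (perfect_sum_graph subgH (part := id)).
Qed.
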